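(* Consider the Labouchere system with any initial list and winning probability $p\in[0,1]$ at each coup. Then $\mathbb{E}[B^\star]<\infty$ if $p>\frac12$, and $\mathbb{E}[B^\star]=\infty$ if $p<\frac12$.
   Context: A gambler plays a sequence of independent coups, each won with probability $p$ and lost with probability $1-p$. The Labouchere system: the bettor chooses a nonempty finite initial list $L_0$ of positive real numbers. At each coup the bet size equals the sum of the first and last numbers on the current list (if only one number remains on the list, the bet size equals that number). After a win, the first and last numbers are canceled from the list (if only one number remains, it is canceled); after a loss, the amount just lost is appended to the end of the list. The system continues until the list is empty. Let $L_n$ be the list after the $n$-th coup, $B_n$ the bet size at the $n$-th coup, and $N$ the first $n$ with $L_n=\varnothing$ (possibly $N=\infty$). The largest bet size is $B^\star=\max_{1\le n\le N}B_n$ if $N<\infty$, and $B^\star=\sup_{n\ge1}B_n$ if $N=\infty$. *)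

(* Defs.v *)
From HB Require Import structures.
From mathcomp Require Import all_boot all_order all_algebra finmap.
From mathcomp Require Import all_classical all_reals all_analysis.

Set Implicit Arguments.
Unset Strict Implicit.
Unset Printing Implicit Defensive.

Import Order.TTheory GRing.Theory Num.Theory.

Local Open Scope classical_set_scope.
Local Open Scope ring_scope.

Definition mutually_independent {d d' : measure_display}
    {T : measurableType d} {T' : measurableType d'} {R : realType}
    (P : probability T R) {I : choiceType} (X : I -> T -> T') : Prop :=
  forall (J : {fset I}) (A : I -> set T'),
    (forall i, i \in J -> measurable (A i)) ->
    P (\bigcap_(i in [set` J]) (X i @^-1` A i)) =
      (\prod_(i <- J) P (X i @^-1` A i))%E.

Section Labouchere.
Context {R : realType}.
Implicit Types (s : seq R).

(* The value at the empty list is a dummy: play has then stopped. *)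
Definition bet_size s : R :=
  match s with
  | [::] => 0
  | [:: x] => x
  | x :: t => x + last x t
  end.

(* [belast y t] is [y :: t] without its last entry. *)
Definition cancel_ends s : seq R :=
  match s with
  | _ :: y :: t => belast y t
  | _ => [::]
  end.

Definition labouchere_step s (won : bool) : seq R :=
  if nilp s then [::]
  else if won then cancel_ends s
  else rcons s (bet_size s).

Section Process.
Context {T : Type}.
Variables (L0 : seq R) (W : nat -> T -> bool).

(* Coups are numbered from 1: [W n] tells whether coup [n.+1], the one played
   with the list [labouchere_list n], is won. *)
Fixpoint labouchere_list (n : nat) (w : T) : seq R :=
  if n is m.+1 then labouchere_step (labouchere_list m w) (W m w) else L0.

(* Meant for n >= 1. *)
Definition labouchere_bet (n : nat) (w : T) : R :=
  bet_size (labouchere_list n.-1 w).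

(* The infimum of the empty set is +oo. *)
Definition stopping_time (w : T) : \bar R :=
  ereal_inf [set (n%:R%:E)%E | n in [set n : nat | labouchere_list n w = [::]]].

Definition largest_bet (w : T) : \bar R :=
  ereal_sup [set (labouchere_bet n w)%:E |
    n in [set n : nat | (1 <= n)%N /\ (n%:R%:E <= stopping_time w)%E]].

End Process.
End Labouchere.

(* Main.v *)
Require Import Defs.
From HB Require Import structures.
From mathcomp Require Import all_boot all_order all_algebra finmap.
From mathcomp Require Import all_classical all_reals all_analysis.
From mathcomp Require Import measurable_realfun ring lra.

(* Let S be the sum of the current list: a win with bet B turns S into S - B and
   a loss turns it into S + B.

   If p > 1/2, taking expectations gives (2 p - 1) E[B_1 + ... + B_n] <= S_0 for
   all n, and the largest bet is at most the sum of all bets.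

   If p < 1/2, put q = 1 - p and l = 1 - p / q. As long as bets are at most b,
   exp (- l S / b) is a supermartingale. A long enough run of losses pushes the
   bet above b, so almost surely either some bet exceeds b or the list becomes
   empty, where S = 0. Hence P(B* <= b) <= exp (- l S_0 / b), so that
   P(B* > b) >= c / b for b >= 1, and summing over b = 2 ^ k yields
   E[B*] = +oo. *)

Set Implicit Arguments.
Unset Strict Implicit.
Unset Printing Implicit Defensive.

Import Order.TTheory GRing.Theory Num.Theory.

Local Open Scope classical_set_scope.
Local Open Scope ring_scope.

(** * Effect of one coup on the list *)

Section LabouchereStep.
Context {R : realType}.
Implicit Types (L : seq R) (m : R).

Lemma sum_labouchere_win L :
  \sum_(x <- labouchere_step L true) x = \sum_(x <- L) x - bet_size L.
Proof.
case: L => [|x [|y t]] /=; rewrite ?big_nil ?big_seq1 ?subrr//.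
rewrite -[LHS]/(\sum_(z <- belast y t) z) big_cons (lastI y t) big_rcons /=; ring.
Qed.

Lemma sum_labouchere_loss L :
  \sum_(x <- labouchere_step L false) x = \sum_(x <- L) x + bet_size L.
Proof.
case: L => [|x t]; first by rewrite /= addr0.
by rewrite -[labouchere_step _ _]/(rcons (x :: t) _) big_rcons.
Qed.

Lemma bet_size_ge m L : 0 <= m -> all (fun x => m <= x) L -> L != [::] ->
  m <= bet_size L.
Proof.
move=> m0; case: L => [|x [|y t]]//=; first by rewrite andbT.
move=> /and3P[mx my mt] _; apply: (le_trans mx); rewrite lerDl.
apply: (le_trans m0).
have /allP : all (fun x => m <= x) (y :: t) by rewrite /= my.
by apply; exact: mem_last.
Qed.

Lemma bet_size_ge0 L : all (fun x => 0 <= x) L -> 0 <= bet_size L.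
Proof. by case: L => // x t /bet_size_ge; apply. Qed.

(** A loss appends the bet, itself at least [m], and a win only removes entries. Used with [m = 0]
    for nonnegativity and with [m > 0] for the runs of losses. *)
Lemma labouchere_step_ge m L b : 0 <= m -> all (fun x => m <= x) L ->
  all (fun x => m <= x) (labouchere_step L b).
Proof.
move=> m0 mL; case: L mL => // x t mL; case: b; last first.
  by rewrite -[labouchere_step _ _]/(rcons (x :: t) _) all_rcons mL bet_size_ge.
case: t mL => // y t /andP[_]; rewrite -[labouchere_step _ _]/(belast y t).
by rewrite -/(all _ (y :: t)) lastI all_rcons => /andP[].
Qed.

(** The first entry, at least [m], stays first, and the lost bet becomes the last entry. *)
Lemma bet_size_loss m L : all (fun x => m <= x) L -> L != [::] ->
  bet_size L + m <= bet_size (labouchere_step L false).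
Proof.
case: L => [|x t]//= /andP[mx _] _; rewrite last_rcons.
by case: t => [|y t]; rewrite /= addrC lerD2r.
Qed.

Definition final_list L (s : seq bool) := foldl (@labouchere_step R) L s.

(** Only bets placed at the coups of [s] are tested, so one more coup is needed before the bet of
    the current list counts. *)
Fixpoint bets_le (b : R) L (s : seq bool) : bool :=
  if s is x :: s' then (bet_size L <= b) && bets_le b (labouchere_step L x) s'
  else true.

End LabouchereStep.

(** * Expectation over finitely many coups *)

Section Expectation.
Context {R : realType}.
Variable p : R.
Implicit Types (F G : seq bool -> R) (n : nat).

(** Conditioning on the first coup, so that inequalities for a general starting list go by induction
    on [n]. *)
Fixpoint expect n F : R :=
  if n is m.+1 then p * expect m (fun s => F (true :: s)) +
                    (1 - p) * expect m (fun s => F (false :: s))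
  else F [::].

Lemma expect_cst n c : expect n (fun=> c) = c.
Proof. by elim: n => //= n ->; ring. Qed.

Lemma expectD n F G : expect n (fun s => F s + G s) = expect n F + expect n G.
Proof. by elim: n F G => //= n IH F G; rewrite !IH; ring. Qed.

Lemma expectZ n c F : expect n (fun s => c * F s) = c * expect n F.
Proof. by elim: n F => //= n IH F; rewrite !IH; ring. Qed.

Lemma expect_sum n (I : Type) (r : seq I) (F : I -> seq bool -> R) :
  expect n (fun s => \sum_(i <- r) F i s) = \sum_(i <- r) expect n (F i).
Proof.
elim: n F => //= n IH F.
by rewrite !IH !mulr_sumr -big_split.
Qed.

Fixpoint bool_seqs n : seq (seq bool) :=
  if n is m.+1 then [seq true :: s | s <- bool_seqs m] ++
                    [seq false :: s | s <- bool_seqs m]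
  else [:: [::]].

Lemma size_bool_seqs n s : s \in bool_seqs n -> size s = n.
Proof.
elim: n s => [|n IH] s /=; first by rewrite inE => /eqP->.
by rewrite mem_cat => /orP[] /mapP[t /IH <- ->].
Qed.

(** Turns a function of the history into a finite combination of indicators, from which
    measurability and the integral are read off. *)
Lemma sum_bool_seqs_eq n F (x : seq bool) : size x = n ->
  F x = \sum_(s <- bool_seqs n) F s * (x == s)%:R.
Proof.
elim: n F x => [|n IH] F [|b x]//=; first by rewrite big_seq1 eqxx mulr1.
move=> [/(IH (fun s => F (b :: s))) ->].
rewrite big_cat !big_map /=; case: b.
  rewrite [X in _ = _ + X]big1 ?addr0; last by move=> s _; rewrite mulr0.
  by apply: eq_bigr => s _; rewrite eqseq_cons.
rewrite [X in _ = X + _]big1 ?add0r; last by move=> s _; rewrite mulr0.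
by apply: eq_bigr => s _; rewrite eqseq_cons.
Qed.

Definition coup_weight (b : bool) : R := if b then p else 1 - p.

Lemma expectE n F :
  expect n F = \sum_(s <- bool_seqs n) F s * \prod_(b <- s) coup_weight b.
Proof.
elim: n F => [|n IH] F /=; first by rewrite big_seq1 big_nil mulr1.
rewrite big_cat !big_map !IH !mulr_sumr /=.
by congr (_ + _); apply: eq_bigr => s _; rewrite big_cons mulrCA.
Qed.

End Expectation.

(** * From the probability space to finite words of outcomes *)

Section History.
Context {R : realType} {d : measure_display} {T : measurableType d}.
Variables (P : probability T R) (p : R) (W : nat -> {RV P >-> bool}).
Hypothesis W_indep : mutually_independent P (fun n => W n : T -> bool).
Hypothesis W_prob : forall n, P (W n @^-1` [set true]) = p%:E.

Definition history n (w : T) : seq bool := mkseq (fun i => W i w) n.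

Lemma prob_coup n b : P (W n @^-1` [set b]) = (coup_weight p b)%:E.
Proof.
case: b => /=; first exact: W_prob.
rewrite (_ : _ @^-1` _ = ~` (W n @^-1` [set true])).
  by rewrite probability_setC ?W_prob//; exact: measurable_funPTI.
by apply/seteqP; split => w /=; case: (W n w).
Qed.

(** Puts the cylinder event in the finite-intersection form that [mutually_independent] takes. *)
Lemma history_preimageE n s : size s = n ->
  [set w | history n w = s] =
  \bigcap_(i in [set` [fset i in iota 0 n]%fset]) (W i @^-1` [set nth false s i]).
Proof.
move=> sn; apply/seteqP; split => w /=.
  by move=> <- i /=; rewrite !inE mem_iota => /= ?; rewrite nth_mkseq.
move=> h; apply: (@eq_from_nth _ false); rewrite size_mkseq ?sn// => i ilt.
by rewrite nth_mkseq//; apply: h; rewrite /= !inE mem_iota.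
Qed.

Lemma measurable_history n s : measurable [set w | history n w = s].
Proof.
have [sn|sn] := eqVneq (size s) n; last first.
  rewrite (_ : [set _ | _] = set0)//; apply/seteqP; split => w //= h.
  by move: sn; rewrite -h size_mkseq eqxx.
rewrite history_preimageE//; apply: bigcap_measurableType => // i _.
exact: measurable_funPTI.
Qed.

Lemma prob_history n s : size s = n ->
  P [set w | history n w = s] = (\prod_(b <- s) coup_weight p b)%:E.
Proof.
move=> sn; rewrite history_preimageE// (W_indep (A := fun i => [set nth false s i]))//.
have -> : (\prod_(i <- [fset i in iota 0 n]%fset) P (W i @^-1` [set nth false s i]) =
          \prod_(i <- iota 0 n) P (W i @^-1` [set nth false s i]))%E.
  apply: perm_big; apply: uniq_perm; [exact: fset_uniq|exact: iota_uniq|].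
  by move=> i; rewrite !inE.
rewrite (eq_bigr (fun i => (coup_weight p (nth false s i))%:E)); last first.
  by move=> i _; exact: prob_coup.
by rewrite prodEFin [in RHS](big_nth false) sn /index_iota subn0.
Qed.

Lemma history_sum_indic n (F : seq bool -> R) w : F (history n w) =
  \sum_(s <- bool_seqs n) F s * \1_[set w | history n w = s] w.
Proof.
rewrite (sum_bool_seqs_eq F (size_mkseq _ n)); apply: eq_bigr => s _.
rewrite indicE; congr (_ * (nat_of_bool _)%:R).
by apply/eqP/idP; rewrite inE.
Qed.

Lemma measurable_fun_history n (F : seq bool -> R) :
  measurable_fun setT (fun w => (F (history n w))%:E).
Proof.
rewrite (_ : (fun _ => _) = fun w => (\sum_(s <- bool_seqs n)
    F s * \1_[set w | history n w = s] w)%:E).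
  apply/measurable_EFinP; apply: measurable_sum => s; apply: measurable_funM => //.
  exact/measurable_indic/measurable_history.
by apply/funext => w; rewrite history_sum_indic.
Qed.

(** Carries [expect] over to the probability space: each word contributes its value times the
    probability of its cylinder, by independence a product of [coup_weight]. *)
Lemma integral_history n (F : seq bool -> R) : (forall s, 0 <= F s) ->
  (\int[P]_w (F (history n w))%:E = (expect p n F)%:E)%E.
Proof.
move=> F0.
under eq_integral do rewrite history_sum_indic -sumEFin.
rewrite ge0_integral_sum//; last 2 first.
- move=> s; apply/measurable_EFinP; apply: measurable_funM => //.
  exact/measurable_indic/measurable_history.
- by move=> s w _; rewrite lee_fin mulr_ge0.
rewrite expectE -sumEFin big_seq [RHS]big_seq; apply: eq_bigr => s /size_bool_seqs sn.
under eq_integral do rewrite EFinM.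
rewrite ge0_integralZl_EFin//; last first.
  by apply/measurable_EFinP; exact/measurable_indic/measurable_history.
rewrite integral_indic//; last exact: measurable_history.
by rewrite setIT EFinM; congr (_ * _)%E; exact: prob_history.
Qed.

Lemma labouchere_listE (L0 : seq R) n w :
  labouchere_list L0 (fun n => W n : T -> bool) n w =
  final_list L0 (history n w).
Proof.
elim: n => // n IH; rewrite [LHS]/= IH.
by rewrite /history mkseqS /final_list foldl_rcons.
Qed.

End History.

(** * Bound on the expected total of the bets *)

Section Superfair.
Context {R : realType}.
Variable p : R.
Hypothesis p01 : 0 <= p <= 1.

(** The first coup lowers the mean of the list sum by [2 * p - 1] times the first bet; induction
    handles both successor lists, and the sum never becomes negative. *)
Lemma sum_expect_bets_le n (L : seq R) : all (fun x => 0 <= x) L ->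
  (2 * p - 1) * \sum_(k < n) expect p k (fun s => bet_size (final_list L s)) <=
  \sum_(x <- L) x.
Proof.
elim: n L => [|n IH] L L0.
  by rewrite big_ord0 mulr0 big_seq; apply: sumr_ge0 => x /(allP L0).
have step_ge0 b := labouchere_step_ge b (lexx 0) L0.
have := (IH _ (step_ge0 true), IH _ (step_ge0 false)).
rewrite big_ord_recl /= big_split /= -!mulr_sumr.
rewrite sum_labouchere_win sum_labouchere_loss => -[].
have /andP[p0 p1] := p01.
have q0 : 0 <= 1 - p by lra.
move=> /(ler_wpM2l p0) + /(ler_wpM2l q0); rewrite /final_list /=; lra.
Qed.

End Superfair.

(** * Exponential supermartingale for [p < 2^-1] *)

Section Subfair.
Context {R : realType}.
Variable p : R.
Hypothesis p01 : 0 <= p <= 1.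
Hypothesis p12 : p < 2^-1.
Variables (b m : R).
Hypothesis b_gt0 : 0 < b.
Hypothesis m_gt0 : 0 < m.
Implicit Types (L : seq R) (n : nat).

Let q := 1 - p.
Let lam := 1 - p / q.

Let q_gt0 : 0 < q. Proof. by rewrite /q; move: p12; lra. Qed.

Lemma rate_gt0 : 0 < lam.
Proof.
by rewrite subr_gt0 ltr_pdivrMr// mul1r /q; move: p12; lra.
Qed.

Definition ruin_bound L := expR (- (lam * (\sum_(x <- L) x) / b)).

(** With [y = expR (- (lam * x / b))] the claim reduces to [p / y + q * y <= 1], that is
    [0 <= (1 - y) * (q * y - p)], which holds because [p / q <= y <= 1]. *)
Lemma ruin_bound_step L : all (fun x => 0 <= x) L -> bet_size L <= b ->
  p * ruin_bound (labouchere_step L true) +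
  q * ruin_bound (labouchere_step L false) <= ruin_bound L.
Proof.
move=> /bet_size_ge0; rewrite /ruin_bound sum_labouchere_win sum_labouchere_loss.
set S := \sum_(x <- L) x; set x := bet_size L => x0 xb.
set y := expR (- (lam * x / b)).
set h := expR (- (lam * S / b)).
have -> : expR (- (lam * (S + x) / b)) = h * y.
  by rewrite -expRD; congr expR; ring.
have -> : expR (- (lam * (S - x) / b)) = h / y.
  by rewrite -expRB; congr expR; ring.
have y_gt0 : 0 < y by exact: expR_gt0.
have h_gt0 : 0 < h by exact: expR_gt0.
have l0 := rate_gt0.
have xb1 : x / b <= 1 by rewrite ler_pdivrMr// mul1r.
have xb0 : 0 <= x / b by rewrite divr_ge0// ltW.
have y1 : y <= 1.
  by rewrite -expR0 ler_expR oppr_le0 -mulrA mulr_ge0// ltW.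
(* [lam] is chosen so that [1 - lam = p / q]; the tangent bound on [expR] and [x <= b] give
   [1 - lam <= y]. *)
have py : p <= q * y.
  have : 1 + - (lam * x / b) <= y by exact: expR_ge1Dx.
  rewrite -mulrA => hy.
  have : lam * (x / b) <= lam by rewrite ler_piMr// ltW.
  move=> hl; have {hl hy} : 1 - lam <= y by lra.
  by rewrite /lam opprB addrC subrK ler_pdivrMr// mulrC.
have -> : p * (h / y) + q * (h * y) = h * ((p + q * y * y) / y).
  by field; rewrite gt_eqF.
rewrite ger_pMr// ler_pdivrMr// mul1r.
have : 0 <= (1 - y) * (q * y - p) by rewrite mulr_ge0 ?subr_ge0.
rewrite /q; lra.
Qed.

(** To be bounded above by quantities tending to 0 as [n] grows. *)
Definition excess n L :=
  expect p n (fun s => (bets_le b L s)%:R) - ruin_bound L.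

Lemma expect_bets_leS n L :
  expect p n.+1 (fun s => (bets_le b L s)%:R) = (bet_size L <= b)%R%:R *
  (p * expect p n (fun s => (bets_le b (labouchere_step L true) s)%:R) +
   q * expect p n (fun s => (bets_le b (labouchere_step L false) s)%:R)).
Proof.
rewrite /=; case: (_ <= b); rewrite ?mul1r//= mul0r.
by rewrite expect_cst; ring.
Qed.

Lemma expect_bets_le_le1 n L : expect p n (fun s => (bets_le b L s)%:R) <= 1.
Proof.
elim: n L => [|n IH] L//; rewrite expect_bets_leS.
case: (_ <= b); rewrite ?mul1r ?mul0r//.
have := IH (labouchere_step L true); have := IH (labouchere_step L false).
rewrite /q; move: p01 => /andP[p0 p1]; have q0 : 0 <= 1 - p by lra.
by move=> /(ler_wpM2l q0) + /(ler_wpM2l p0); lra.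
Qed.

(** If the bet is at most [b], this is the supermartingale inequality. Otherwise the indicator
    vanishes and the excess is at most 0, hence the signs of [C1] and [C2]. *)
Lemma excess_step n L C1 C2 : all (fun x => 0 <= x) L -> 0 <= C1 -> 0 <= C2 ->
  excess n (labouchere_step L true) <= C1 ->
  excess n (labouchere_step L false) <= C2 ->
  excess n.+1 L <= p * C1 + q * C2.
Proof.
move=> L0 C10 C20; rewrite /excess expect_bets_leS => e1 e2.
have p0 : 0 <= p by case/andP: p01.
have [Lb|Lb] := leP (bet_size L) b; last first.
  rewrite mul0r sub0r (@le_trans _ _ 0) ?oppr_le0 ?expR_ge0//.
  by rewrite addr_ge0// mulr_ge0// ltW.
have := ruin_bound_step L0 Lb; rewrite mul1r.
move: (ler_wpM2l p0 e1) (ler_wpM2l (ltW q_gt0) e2); lra.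
Qed.

Lemma excess_nil n : excess n [::] <= 0.
Proof.
rewrite /excess /ruin_bound big_nil mulr0 mul0r oppr0 expR0 subr_le0.
exact: expect_bets_le_le1.
Qed.

Lemma excess_gt n L : b < bet_size L -> excess n.+1 L <= 0.
Proof.
move=> bL; rewrite /excess expect_bets_leS (leNgt (bet_size L)) bL.
by rewrite mul0r sub0r oppr_le0 expR_ge0.
Qed.

Lemma excess_le1 n L : excess n L <= 1.
Proof.
rewrite lerBlDr (le_trans (expect_bets_le_le1 _ _))// lerDl; exact: expR_ge0.
Qed.

(* Each loss raises the bet by at least [m], so a run of [i] losses brings it
   above [b]. *)
Lemma excess_run (C : R) (n0 : nat) : 0 <= C ->
  (forall n L, (n0 <= n)%N -> all (fun x => m <= x) L -> excess n L <= C) ->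
  forall i n L, (n0 + i < n)%N -> all (fun x => m <= x) L ->
    (L != [::] -> b < bet_size L + m *+ i) ->
    excess n L <= (1 - q ^+ i) * C.
Proof.
move=> C0 HC; elim => [|i IH] [//|n] L; rewrite ltnS => ni mL bL.
  rewrite expr0 subrr mul0r; have [->|L0] := eqVneq L [::]; first exact: excess_nil.
  by apply: excess_gt; have := bL L0; rewrite mulr0n addr0.
have q1 : q <= 1 by rewrite /q gerBl; case/andP: p01.
have qi k : 0 <= 1 - q ^+ k by rewrite subr_ge0 exprn_ile1// ltW.
have m0 := ltW m_gt0.
have [->|L0] := eqVneq L [::].
  by rewrite (le_trans (excess_nil _))// mulr_ge0.
have nonneg : all (fun x => 0 <= x) L.
  by apply: sub_all mL => x; exact: le_trans.
(* A win leaves only the generic bound [C]; after a loss the induction hypothesis applies with one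
   loss fewer to go. *)
have -> : (1 - q ^+ i.+1) * C = p * C + q * ((1 - q ^+ i) * C).
  by rewrite exprS /q; ring.
apply: excess_step => //; first by rewrite mulr_ge0.
- by apply: HC; [rewrite (leq_trans _ ni)// leq_addr|exact: labouchere_step_ge].
- apply: IH; [by rewrite -addnS|exact: labouchere_step_ge|move=> _].
  rewrite (lt_le_trans (bL L0))// mulrS addrA lerD2r.
  exact: bet_size_loss.
Qed.

(** Iterates [excess_run]: each block of [N] coups multiplies the bound by the chance that the block
    does not begin with [K] losses. *)
Lemma excess_geometric : exists (N : nat) (r : R), 0 <= r < 1 /\
  forall j n L, (j * N <= n)%N -> all (fun x => m <= x) L -> excess n L <= r ^+ j.
Proof.
pose K := Num.bound (b / m).
have bK : b < m *+ K.
  rewrite -mulr_natl -ltr_pdivrMr//; apply: archi_boundP.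
  by rewrite divr_ge0// ltW.
have q1 : q <= 1 by rewrite /q gerBl; case/andP: p01.
(* [K] losses bring the bet above [b]; one further coup makes [bets_le] test it. *)
exists K.+1, (1 - q ^+ K); split.
  by rewrite subr_ge0 exprn_ile1 ?(ltW q_gt0)//= ltrBlDr ltrDl exprn_gt0.
elim => [|j IH] n L jn mL; first by rewrite expr0 excess_le1.
rewrite exprS; apply: (@excess_run _ (j * K.+1)) => //.
- by rewrite exprn_ge0// subr_ge0 exprn_ile1 ?(ltW q_gt0).
- by rewrite (leq_trans _ jn)// mulSnr addnS.
- move=> L0; rewrite (lt_le_trans bK)// lerDr bet_size_ge0//.
  by apply: sub_all mL => x; apply: le_trans; exact: ltW.
Qed.

Lemma expect_bets_le_limit L e : all (fun x => m <= x) L -> 0 < e ->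
  exists N : nat, forall n, (N <= n)%N ->
    expect p n (fun s => (bets_le b L s)%:R) <= ruin_bound L + e.
Proof.
move=> mL e0; have [N [r [/andP[r0 r1] H]]] := excess_geometric.
have [j rj] : exists j, r ^+ j < e.
  have /cvgrPdist_lt /(_ e e0) [j _ /(_ j (leqnn j))] : r ^+ n @[n --> \oo] --> 0.
    by apply: cvg_expr; rewrite ger0_norm.
  by rewrite /= sub0r normrN ger0_norm ?exprn_ge0//; exists j.
exists (j * N)%N => n jn; rewrite addrC -lerBlDr.
exact: le_trans (H j n L jn mL) (ltW rj).
Qed.

(** With [z] equal to [lam] times the list sum, [expR (- (z / b))] is at most
    [(1 + z / b)^-1 = 1 - z / (b + z)], and [b + z <= (1 + z) * b] as [1 <= b]. *)
Lemma ruin_bound_le L : 1 <= b -> 0 < \sum_(x <- L) x ->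
  ruin_bound L <= 1 - lam * (\sum_(x <- L) x) /
                      (1 + lam * (\sum_(x <- L) x)) / b.
Proof.
rewrite /ruin_bound => b1 S0.
have : 0 < lam * \sum_(x <- L) x by rewrite mulr_gt0// rate_gt0.
move: (lam * _) => z z0; rewrite expRN.
have zb0 : 0 < z / b by rewrite divr_gt0.
have := expR_ge1Dx (z / b) => hz.
apply: (@le_trans _ _ (1 + z / b)^-1).
  by rewrite lef_pV2// posrE ?expR_gt0// addr_gt0.
have -> : (1 + z / b)^-1 = 1 - z / (b + z).
  by field; rewrite !gt_eqF// ?addr_gt0.
rewrite lerD2l lerN2 -mulrA ler_pM2l// -invfM lef_pV2 ?posrE ?mulr_gt0 ?addr_gt0//.
by rewrite mulrDl mul1r lerD2l ler_peMr// ltW.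
Qed.

End Subfair.

(** * Largest bet as a supremum over all coups *)

Section LargestBet.
Context {R : realType} {T : Type}.
Variables (L0 : seq R) (W : nat -> T -> bool).
Hypothesis L0_neq0 : L0 <> [::].
Hypothesis L0_ge0 : all (fun x => 0 <= x) L0.
Local Notation bet n w := (bet_size (labouchere_list L0 W n w)).

Lemma labouchere_list_ge0 n w : all (fun x => 0 <= x) (labouchere_list L0 W n w).
Proof.
elim: n => [|n IH]; first exact: L0_ge0.
exact: (labouchere_step_ge _ (lexx 0)).
Qed.

Lemma labouchere_list_nil n k w : (n <= k)%N ->
  labouchere_list L0 W n w = [::] -> labouchere_list L0 W k w = [::].
Proof.
by move=> /subnK <- nil; elim: (k - n)%N => // j IH; rewrite addSn /= IH.
Qed.

Lemma le_stopping_time n w : labouchere_list L0 W n w != [::] ->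
  (n.+1%:R%:E <= stopping_time L0 W w)%E.
Proof.
move=> nz; apply: le_ereal_inf_tmp => _ [k /= k0 <-].
rewrite lee_fin ler_nat ltnNge; apply/negP => kn.
by move: nz; rewrite (labouchere_list_nil kn k0).
Qed.

(** While the list is nonempty, the bet belongs to the supremum; afterwards the dummy bet 0 is below
    the first bet. *)
Lemma bet_le_largest n w : ((bet n w)%:E <= largest_bet L0 W w)%E.
Proof.
have le_sup k : labouchere_list L0 W k w != [::] ->
    ((bet k w)%:E <= largest_bet L0 W w)%E.
  move=> nz; apply: ereal_sup_ubound; exists k.+1 => //=.
  by split => //; exact: le_stopping_time.
have [nz|] := eqVneq (labouchere_list L0 W n w) [::]; last exact: le_sup.
rewrite nz; apply: le_trans (le_sup 0%N _); last exact/eqP.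
by rewrite lee_fin bet_size_ge0.
Qed.

(** Removing the stopping time leaves a countable supremum of functions of the history, so that
    measurability follows. *)
Lemma largest_betE w :
  largest_bet L0 W w = esups (fun n => (bet n w)%:E) 0.
Proof.
apply/eqP; rewrite eq_le; apply/andP; split.
  apply: ge_ereal_sup => _ [n _ <-].
  by apply: ereal_sup_ubound; exists n.-1.
by apply: ge_ereal_sup => _ [n _ <-]; exact: bet_le_largest.
Qed.

End LargestBet.

(** * Lower bound by powers of two *)

Section DyadicBound.
Context {R : realType}.
Implicit Types (L : seq R) (s : seq bool).

Lemma not_bets_le b L s : ~~ bets_le b L s ->
  exists2 k, (k <= size s)%N & b < bet_size (final_list L (take k s)).
Proof.
elim: s L => // x s IH L /=; rewrite negb_and -ltNge => /orP[bL|].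
  by exists 0%N.
by move=> /IH[k ks bk]; exists k.+1.
Qed.

(* Half the sum of the powers of two that some bet exceeds: a lower bound for
   the largest bet that is linear in the events [~~ bets_le (2 ^+ k)]. *)
Definition dyadic_bound L (K : nat) s : R :=
  \sum_(k < K) 2 ^+ k / 2 * (~~ bets_le (2 ^+ k) L s)%:R.

Lemma dyadic_bound_ge0 L K s : 0 <= dyadic_bound L K s.
Proof. by apply: sumr_ge0 => k _; rewrite !mulr_ge0// invr_ge0. Qed.

(** If [2 ^+ K] is exceeded, the terms up to [K] add up to at most [2 ^+ K <= M] by the geometric
    sum; otherwise the top term is 0 and the induction hypothesis applies. *)
Lemma dyadic_bound_le L K s (M : R) : 0 <= M ->
  (forall k : nat, ~~ bets_le (2 ^+ k) L s -> 2 ^+ k <= M) ->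
  dyadic_bound L K s <= M.
Proof.
move=> M0 HM; rewrite /dyadic_bound; elim: K => [|K IH]; first by rewrite big_ord0.
rewrite big_ord_recr /=; case: (boolP (bets_le _ _ _)) => [_|/HM hK].
  by rewrite mulr0 addr0.
rewrite mulr1.
suff : \sum_(k < K) 2 ^+ k / 2 * (~~ bets_le (2 ^+ k) L s)%:R <= 2 ^+ K / 2 :> R.
  by move=> h; apply: le_trans hK; lra.
elim: K {IH hK} => [|K IH]; first by rewrite big_ord0 divr_ge0.
rewrite big_ord_recr /= exprS.
have : 2 ^+ K / 2 * (~~ bets_le (2 ^+ K) L s)%:R <= 2 ^+ K / 2 :> R.
  by rewrite ler_piMr ?divr_ge0 ?exprn_ge0//; case: bets_le.
by move: IH; lra.
Qed.

(** The probability of exceeding [2 ^+ k] is at least of order [2 ^- k], so each term contributes a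
    constant independent of [k]. *)
Lemma expect_dyadic_bound_ge (p m : R) L : 0 <= p <= 1 -> p < 2^-1 -> 0 < m ->
  L <> [::] -> all (fun x => m <= x) L ->
  exists2 c : R, 0 < c & forall K, exists N, forall n, (N <= n)%N ->
    c *+ K <= expect p n (dyadic_bound L K).
Proof.
move=> p01 p12 m0 L0 mL; pose S := \sum_(x <- L) x.
have S0 : 0 < S.
  case: L L0 mL @S => // x t _ /= /andP[mx mt]; rewrite big_cons ltr_wpDr//.
    by rewrite big_seq; apply: sumr_ge0 => y /(allP mt); apply: le_trans; exact: ltW.
  exact: lt_le_trans mx.
pose a := (1 - p / (1 - p)) * S.
have a0 : 0 < a by rewrite mulr_gt0// rate_gt0.
pose c := a / (1 + a); have c0 : 0 < c by rewrite divr_gt0// addr_gt0.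
exists (c / 4) => [|K]; first by rewrite divr_gt0.
have tail k : exists N : nat, forall n, (N <= n)%N ->
    c / 4 <= 2 ^+ k / 2 * expect p n (fun s => (~~ bets_le (2 ^+ k) L s)%:R).
  have b0 : 0 < 2 ^+ k :> R by rewrite exprn_gt0.
  have b1 : 1 <= 2 ^+ k :> R by rewrite exprn_ege1// ler1n.
  (* Half of the gap [c / 2 ^+ k] is given up to the limit; the weight [2 ^+ k / 2] turns the other
     half into [c / 4]. *)
  have e0 : 0 < c / 2 ^+ k / 2 by rewrite divr_gt0// divr_gt0.
  have [N HN] := expect_bets_le_limit p01 p12 b0 m0 mL e0.
  exists N => n /HN; have := ruin_bound_le p12 b0 b1 S0.
  rewrite -/S -/a -/c.
  have -> : expect p n (fun s => (~~ bets_le (2 ^+ k) L s)%:R) =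
            1 - expect p n (fun s => (bets_le (2 ^+ k) L s)%:R) :> R.
    rewrite -[X in X - _](expect_cst p n) -mulN1r -expectZ -expectD.
    congr expect; apply/funext => s.
    by case: bets_le => /=; ring.
  set v := expect _ _ _ => h1 h2.
  have : c / 2 ^+ k / 2 <= 1 - v by lra.
  move=> /(ler_wpM2l (ltW b0)); have -> : 2 ^+ k * (c / 2 ^+ k / 2) = c / 2.
    by field; rewrite gt_eqF.
  lra.
elim: K => [|K [N HN]]; first by exists 0%N => n _; rewrite mulr0n expect_sum big_ord0.
have [N' HN'] := tail K; exists (maxn N N') => n; rewrite geq_max => /andP[nN nN'].
rewrite expect_sum big_ord_recr /= mulrSr lerD//.
  by rewrite -expect_sum; exact: HN.
by rewrite expectZ; exact: HN'.
Qed.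

End DyadicBound.

(** * Transfer to integrals and conclusion *)

Theorem corollary1 (R : realType) (d : measure_display) (T : measurableType d)
    (P : probability T R) (p : R) (W : nat -> {RV P >-> bool}) (L0 : seq R)
    (hp : 0 <= p <= 1)
    (W_indep : mutually_independent P (fun n => W n : T -> bool))
    (W_prob : forall n, P (W n @^-1` [set true]) = p%:E)
    (L0_neq0 : L0 <> [::])
    (L0_gt0 : forall x, x \in L0 -> 0 < x) :
  (2^-1 < p ->
    (\int[P]_w largest_bet L0 (fun n => W n : T -> bool) w < +oo)%E) /\
  (p < 2^-1 ->
    (\int[P]_w largest_bet L0 (fun n => W n : T -> bool) w = +oo)%E).
Proof.
have L0_ge0 : all (fun x => 0 <= x) L0 by apply/allP => x /L0_gt0 /ltW.
pose V n : T -> bool := W n.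
have betE n w : bet_size (labouchere_list L0 V n w) =
    bet_size (final_list L0 (history W n w)) by rewrite -labouchere_listE.
have bet_ge0 n w : 0 <= bet_size (labouchere_list L0 V n w).
  exact/bet_size_ge0/labouchere_list_ge0.
have mbet n : measurable_fun setT (fun w => (bet_size (labouchere_list L0 V n w))%:E).
  rewrite (_ : (fun _ => _) = fun w => (bet_size (final_list L0 (history W n w)))%:E).
    exact: (measurable_fun_history W n (fun s => bet_size (final_list L0 s))).
  by apply/funext => w; rewrite betE.
have mB : measurable_fun setT (largest_bet L0 V).
  rewrite (_ : largest_bet L0 V = fun w =>
      esups (fun n => (bet_size (labouchere_list L0 V n w))%:E) 0%N).
    exact: measurable_fun_esups.
  by apply/funext => w; exact: largest_betE.
have B_ge0 w : (0 <= largest_bet L0 V w)%E.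
  by apply: (le_trans _ (bet_le_largest V L0_neq0 L0_ge0 0%N w)); rewrite lee_fin.
split => p12.
- apply: (@le_lt_trans _ _ (((\sum_(x <- L0) x) / (2 * p - 1))%:E)); last exact: ltry.
  (* The supremum of the bets is at most their series, each bet being at most a partial sum. *)
  apply: (@le_trans _ _ (\int[P]_w (\sum_(0 <= n <oo)
      (bet_size (labouchere_list L0 V n w))%:E))%E).
    apply: ge0_le_integral => //.
      apply: ge0_emeasurable_sum => // n w _ _; exact: bet_ge0.
    move=> w _; rewrite largest_betE//; apply: ge_ereal_sup => _ [n _ <-].
    apply: le_trans (nneseries_lim_ge n.+1 _) => [|k _ _]; last exact: bet_ge0.
    rewrite big_nat_recr//= leeDr// sume_ge0// => k _; exact: bet_ge0.
  rewrite integral_nneseries//; last by move=> n w _; exact: bet_ge0.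
  apply: lime_le.
    by apply: is_cvg_nneseries => n _ _; apply: integral_ge0 => w _; exact: bet_ge0.
  apply: nearW => n.
  rewrite big_mkord (eq_bigr (fun k : 'I_n =>
      (expect p k (fun s => bet_size (final_list L0 s)))%:E)); last first.
    move=> k _; under eq_integral do rewrite betE.
    apply: (integral_history W_indep W_prob k) => s.
    apply: bet_size_ge0; rewrite /final_list.
    by elim/last_ind: s => // s b; rewrite foldl_rcons; apply: labouchere_step_ge.
  rewrite sumEFin lee_fin ler_pdivlMr; last by lra.
  by rewrite mulrC; exact: sum_expect_bets_le.
(* The minimum of 1 and the entries serves as [m]. *)
- have [m m0 mL0] : exists2 m : R, 0 < m & all (fun x => m <= x) L0.
    elim: (L0) L0_gt0 => [|x t IH] t0; first by exists 1.
    have [|m m0 mt] := IH; first by move=> y yt; apply: t0; rewrite inE yt orbT.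
    exists (Order.min x m); first by rewrite lt_min m0 t0// mem_head.
    rewrite /= ge_min lexx/=; apply: sub_all mt => y.
    by rewrite ge_min => ->; rewrite orbT.
  have [c c0 Hc] := expect_dyadic_bound_ge hp p12 m0 L0_neq0 mL0.
  (* The integral is shown to be at least every [A > 0]: [K] powers of two suffice for [A], and [N]
     coups for these powers. *)
  apply/eqyP => A A0; pose K := Num.bound (A / c).
  have AK : A <= c *+ K.
    rewrite -mulr_natl -ler_pdivrMr//; apply/ltW/archi_boundP.
    by rewrite divr_ge0// ltW.
  have [N /(_ N (leqnn N)) HN] := Hc K.
  apply: (@le_trans _ _ (expect p N (dyadic_bound L0 K))%:E).
    by rewrite lee_fin (le_trans AK).
  rewrite -(integral_history W_indep W_prob); last exact: dyadic_bound_ge0.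
  apply: ge0_le_integral => //.
  + by move=> w _; rewrite lee_fin dyadic_bound_ge0.
  + exact: measurable_fun_history.
  move=> w _; have := B_ge0 w.
  have bB n := bet_le_largest V L0_neq0 L0_ge0 n w.
  move: (largest_bet L0 V w) bB => [r||] bB.
  2: by move=> _; exact: leey.
  2: by rewrite leeNy_eq.
  rewrite !lee_fin => r0; apply: dyadic_bound_le => // k /not_bets_le[j jN kj].
  apply: le_trans (ltW kj) _; move: (bB j); rewrite lee_fin betE.
  (* The first [j] outcomes of the history of length [N] are the history of length [j]. *)
  rewrite /history /mkseq -map_take take_iota.
  by move: jN; rewrite size_mkseq => /minn_idPl ->.
Qed.
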